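(* Consider the set of all real vectors $(\zeta,\tau,\beta,\nu,\omega,\sigma)$ satisfying the constraints (Sec), (McC), (Feed), (Split) listed in the context together with $0\le\zeta_{i,j}\le1$ for all $[i,j]\in\mathcal T$. Then for every vector in this set and every $[i,j]\in\mathcal P$, the subvector $$\bigl((\sigma_{i,k,l,j})_{i\le k\le j-1,\ i+1\le l\le k+1},\ (\tau_{i,k,j})_{i\le k\le j-1},\ (\beta_{i,l,j})_{i+1\le l\le j},\ \zeta_{i,j}\bigr)$$ is contained in the convex hull of the set $S_{i,j}$ of all $(\sigma,\tau,\beta,\zeta)$ (with the indices just displayed) such that $$\begin{aligned} &\sigma_{i,k,l,j}=\tau_{i,k,j}\,\beta_{i,l,j}, && i\le k\le j-1,\ i+1\le l\le k+1,\\ &\tau_{i,k,j}\,\beta_{i,l,j}=0, && i\le k\le j-2,\ k+2\le l\le j,\\ &\sum_{k=i}^{j-1}\tau_{i,k,j}=\sum_{l=i+1}^{j}\beta_{i,l,j}=\zeta_{i,j},\\ &\tau_{i,k,j},\ \beta_{i,l,j},\ \zeta_{i,j}\in\{0,1\}, && i\le k\le j-1,\ i+1\le l\le j. \end{aligned}$$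
   Context: Let $N\ge2$ be an integer, $\mathcal T=\{[i,j]:1\le i\le j\le N\}$ and $\mathcal P=\mathcal T\setminus\{[i,i]:1\le i\le N\}$. Real variables: $\zeta_{i,j}$ for $[i,j]\in\mathcal T$; $\tau_{i,k,j}$ ($i\le k\le j-1$), $\beta_{i,l,j}$ ($i+1\le l\le j$) and $\sigma_{i,k,l,j}$ ($i\le k\le j-1$, $i+1\le l\le k+1$) for $[i,j]\in\mathcal P$; $\nu_{i,k,j}$ for $1\le i\le k\le j\le N$ and $\omega_{i,l,j}$ for $1\le i\le l\le j\le N$. Conventions: $\nu_{i,n,m}:=1$ if $n=m+1$, and $\omega_{n,m,j}:=1$ if $n=m+1$. (Sec) For all $[i,j]\in\mathcal P$: $\tau_{i,k,j}=\nu_{i,k+1,j-1}-\nu_{i,k,j-1}-\nu_{i,k+1,j}+\nu_{i,k,j}$ for $i\le k\le j-1$; and $\beta_{i,l,j}=\omega_{i+1,l-1,j}-\omega_{i,l-1,j}-\omega_{i+1,l,j}+\omega_{i,l,j}$ for $i+1\le l\le j$. (McC) $\nu_{i,j,j}=\omega_{i,i,j}=1-\zeta_{i,j}$ for all $[i,j]\in\mathcal T$. For all $[i,j]\in\mathcal P$: $\max\{0,\nu_{i,k,m}+\nu_{i,n,j}-\nu_{i,n,m}\}\le\nu_{i,k,j}\le\min\{\nu_{i,k,m},\nu_{i,n,j}\}$ for all $i\le k\le j-1$, $k\le m\le j-1$, $k+1\le n\le m+1$; and $\max\{0,\omega_{i,m,j}+\omega_{n,l,j}-\omega_{n,m,j}\}\le\omega_{i,l,j}\le\min\{\omega_{i,m,j},\omega_{n,l,j}\}$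 for all $i+1\le l\le j$, $i\le m\le l-1$, $i+1\le n\le m+1$. (Feed) $\zeta_{1,N}=1$ and $\zeta_{i,i}=1$ for $i=1,\dots,N$. (Split) For all $[i,j]\in\mathcal P$: $\sum_{l=i+1}^{k+1}\sigma_{i,k,l,j}=\tau_{i,k,j}$ for $i\le k\le j-1$; $\sum_{k=l-1}^{j-1}\sigma_{i,k,l,j}=\beta_{i,l,j}$ for $i+1\le l\le j$; and $\sigma_{i,k,l,j}\ge0$ for $i\le k\le j-1$, $i+1\le l\le k+1$. *)

(* Defs.v *)
From HB Require Import structures.
From mathcomp Require Import all_boot all_order all_algebra.
From mathcomp Require Import classical_sets reals.

Set Implicit Arguments.
Unset Strict Implicit.
Unset Printing Implicit Defensive.

Import Order.TTheory GRing.Theory Num.Theory.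

Local Open Scope classical_set_scope.
Local Open Scope ring_scope.

Definition conv_hull (R : realType) (E : lmodType R) (A : set E) : set E :=
  [set x | exists (n : nat) (w : 'I_n -> R) (p : 'I_n -> E),
     [/\ forall r, 0 <= w r, \sum_(r < n) w r = 1, forall r, A (p r)
       & x = \sum_(r < n) w r *: p r]].

Definition inT (N i j : nat) : bool := [&& 1 <= i, i <= j & j <= N]%N.

Definition inP (N i j : nat) : bool := [&& 1 <= i, i < j & j <= N]%N.

(* Families are total functions on natural-number indices, with the indices in
   the order in which they are written as subscripts (sigma i k l j).  All the
   constraints and the conclusion only involve the entries whose indices are in
   the mathematical range; the remaining entries are irrelevant. *)
Record variables (R : Type) := Variables {
  zeta : nat -> nat -> R;
  tau : nat -> nat -> nat -> R;
  beta : nat -> nat -> nat -> R;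
  nu : nat -> nat -> nat -> R;
  omega : nat -> nat -> nat -> R;
  sigma : nat -> nat -> nat -> nat -> R }.

(* nu and omega extended by the conventions nu_{i,m+1,m} = 1 and
   omega_{m+1,m,j} = 1. *)
Definition nuc (R : realType) (v : variables R) (i n m : nat) : R :=
  if n == m.+1 then 1 else nu v i n m.

Definition omegac (R : realType) (v : variables R) (n m j : nat) : R :=
  if n == m.+1 then 1 else omega v n m j.

(* Throughout, k <= j - 1 is written k < j, and i + 1 <= l is written i < l.
   Every predecessor below is taken of an index that is at least 2. *)

Definition secant (R : realType) (N : nat) (v : variables R) : Prop :=
  forall i j : nat, inP N i j ->
    (forall k : nat, (i <= k < j)%N ->
       tau v i k j = nuc v i k.+1 j.-1 - nuc v i k j.-1
                     - nuc v i k.+1 j + nuc v i k j) /\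
    (forall l : nat, (i < l <= j)%N ->
       beta v i l j = omegac v i.+1 l.-1 j - omegac v i l.-1 j
                      - omegac v i.+1 l j + omegac v i l j).

Definition mccormick (R : realType) (N : nat) (v : variables R) : Prop :=
  (forall i j : nat, inT N i j ->
     nuc v i j j = 1 - zeta v i j /\ omegac v i i j = 1 - zeta v i j) /\
  (forall i j : nat, inP N i j ->
     (forall k m n : nat,
        (i <= k < j)%N -> (k <= m < j)%N -> (k < n <= m.+1)%N ->
        Num.max 0 (nuc v i k m + nuc v i n j - nuc v i n m) <= nuc v i k j
          <= Num.min (nuc v i k m) (nuc v i n j)) /\
     (forall l m n : nat,
        (i < l <= j)%N -> (i <= m < l)%N -> (i < n <= m.+1)%N ->
        Num.max 0 (omegac v i m j + omegac v n l j - omegac v n m j)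
          <= omegac v i l j
          <= Num.min (omegac v i m j) (omegac v n l j))).

Definition feed_streams (R : realType) (N : nat) (v : variables R) : Prop :=
  zeta v 1 N = 1 /\ forall i : nat, (1 <= i <= N)%N -> zeta v i i = 1.

Definition sigma_split (R : realType) (N : nat) (v : variables R) : Prop :=
  forall i j : nat, inP N i j ->
    [/\ forall k : nat, (i <= k < j)%N ->
          \sum_(i.+1 <= l < k.+2) sigma v i k l j = tau v i k j,
        forall l : nat, (i < l <= j)%N ->
          \sum_(l.-1 <= k < j) sigma v i k l j = beta v i l j
      & forall k l : nat, (i <= k < j)%N -> (i < l <= k.+1)%N ->
          0 <= sigma v i k l j].

Definition relaxation (R : realType) (N : nat) : set (variables R) :=
  [set v | [/\ secant N v, mccormick N v, feed_streams N v, sigma_split N v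
             & forall i j : nat, inT N i j -> 0 <= zeta v i j <= 1]].

Arguments relaxation R N : clear implicits.

(* Index sets for fixed i and j: k with i <= k <= j - 1, l with i + 1 <= l <= j,
   and the pairs (k, l) of such indices with l <= k + 1. *)
Definition kidx (i j : nat) := {k : 'I_j | (i <= k)%N}.

Definition lidx (i j : nat) := {l : 'I_j.+1 | (i < l)%N}.

Definition klidx (i j : nat) :=
  {kl : kidx i j * lidx i j | (val (val kl.2) <= (val (val kl.1)).+1)%N}.

Definition subvec_space (R : realType) (i j : nat) : lmodType R :=
  ({ffun klidx i j -> R^o} * {ffun kidx i j -> R^o} *
   {ffun lidx i j -> R^o} * R^o)%type.

Definition subvector (R : realType) (v : variables R) (i j : nat) :
    subvec_space R i j :=
  ([ffun x : klidx i j => sigma v i (val (val x).1) (val (val x).2) j],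
   [ffun k : kidx i j => tau v i (val k) j],
   [ffun l : lidx i j => beta v i (val l) j],
   zeta v i j).

Definition product_set (R : realType) (i j : nat) : set (subvec_space R i j) :=
  [set x : subvec_space R i j |
     let s : {ffun klidx i j -> R} := x.1.1.1 in
     let t : {ffun kidx i j -> R} := x.1.1.2 in
     let b : {ffun lidx i j -> R} := x.1.2 in
     let z : R := x.2 in
     [/\ forall kl : klidx i j, s kl = t (val kl).1 * b (val kl).2,
         forall (k : kidx i j) (l : lidx i j),
           ((val (val k)).+2 <= val (val l))%N -> t k * b l = 0,
         \sum_(k : kidx i j) t k = z /\ \sum_(l : lidx i j) b l = z
       & [/\ forall k : kidx i j, t k = 0 \/ t k = 1,
             forall l : lidx i j, b l = 0 \/ b l = 1
           & z = 0 \/ z = 1]]].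

Arguments product_set R i j : clear implicits.

(* Main.v *)
Require Import Defs.
From mathcomp Require Import all_boot all_order all_algebra.
From mathcomp Require Import classical_sets reals.
From mathcomp Require Import ring zify.

(** The sums of [tau] and of [beta] telescope and, once the boundary terms
    [nu i i j] and [omega i j j] are seen to vanish (because the diagonal
    [zeta] equal 1), both are equal to [zeta i j].  By the splitting
    constraints this is also the total mass of [sigma].  The subvector is then
    the barycenter of the elements of the product set with a single split
    (k, l), weighted by [sigma i k l j], and of the origin, with the remaining
    weight [1 - zeta i j]. *)

Import Order.TTheory GRing.Theory Num.Theory.
Local Open Scope ring_scope.

Lemma big_sub_type (V : nmodType) (T : finType) (P : pred T) (F : T -> V) :
  \sum_(x : {x | P x}) F (val x) = \sum_(x | P x) F x.
Proof.
rewrite (reindex_omap (val : {x | P x} -> T) insub) /=; last first.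
  by move=> x Px; rewrite insubT.
apply: eq_bigl => x; by rewrite valK eqxx andbT (valP x).
Qed.

(** The origin absorbs the missing weight: it is added as one more point, indexed by [unit], and
    [enum_val] turns [I + unit] into the ordinals that [conv_hull] asks for. *)
Lemma conv_hull_subconvex (R : realType) (E : lmodType R) (A : set E)
    (I : finType) (w : I -> R) (p : I -> E) :
  A 0 -> (forall x, 0 <= w x) -> \sum_x w x <= 1 -> (forall x, A (p x)) ->
  conv_hull A (\sum_x w x *: p x).
Proof.
move=> A0 w0 w1 Ap.
pose w' (x : I + unit) := if x is inl x then w x else 1 - \sum_x w x.
pose p' (x : I + unit) := if x is inl x then p x else 0.
exists #|{: I + unit}|, (w' \o enum_val), (p' \o enum_val); split => [r||r|].
- by rewrite /=; case: (enum_val r) => [x|[]] //=; rewrite subr_ge0.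
- rewrite -(big_enum_val w') big_sumType /= big_const card_unit /=.
  by rewrite addr0 addrC subrK.
- by rewrite /=; case: (enum_val r).
- rewrite -(big_enum_val (fun x => w' x *: p' x)) big_sumType /=.
  by rewrite [X in _ + X]big1 ?addr0 // => x _; rewrite scaler0.
Qed.

Lemma sum_kidx (V : nmodType) (i j : nat) (F : nat -> V) :
  \sum_(k : kidx i j) F (val (val k)) = \sum_(i <= k < j) F k.
Proof.
rewrite (big_sub_type V _ (fun k : 'I_j => (i <= k)%N) (fun k : 'I_j => F k)).
by rewrite big_geq_mkord.
Qed.

Lemma sum_lidx (V : nmodType) (i j : nat) (F : nat -> V) :
  \sum_(l : lidx i j) F (val (val l)) = \sum_(i.+1 <= l < j.+1) F l.
Proof.
rewrite (big_sub_type V _ (fun l : 'I_j.+1 => (i < l)%N) (fun l : 'I_j.+1 => F l)).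
by rewrite big_geq_mkord.
Qed.

Lemma sum_klidx (V : nmodType) (i j : nat) (F : kidx i j -> lidx i j -> V) :
  \sum_(x : klidx i j) F (val x).1 (val x).2 =
  \sum_(k : kidx i j) \sum_(l : lidx i j | (val (val l) <= (val (val k)).+1)%N)
    F k l.
Proof.
rewrite pair_big_dep /=.
exact: (big_sub_type V _
  (fun kl : kidx i j * lidx i j => (val (val kl.2) <= (val (val kl.1)).+1)%N)
  (fun kl => F kl.1 kl.2)).
Qed.

Lemma sum_lidx_le (V : nmodType) (i j k : nat) (F : nat -> V) : (k < j)%N ->
  \sum_(l : lidx i j | (val (val l) <= k.+1)%N) F (val (val l)) =
  \sum_(i.+1 <= l < k.+2) F l.
Proof.
move=> kj.
rewrite big_mkcond (sum_lidx V i j (fun l => if (l <= k.+1)%N then F l else 0)).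
rewrite -big_mkcond /=.
by rewrite (big_nat_widen i.+1 k.+2 j.+1) //; lia.
Qed.

(** As [i < l], the predecessor is a true one and [l.-1 <= k] already forces [i <= k]. *)
Lemma sum_kidx_ge (V : nmodType) (i j l : nat) (F : nat -> V) : (i < l)%N ->
  \sum_(k : kidx i j | (l <= (val (val k)).+1)%N) F (val (val k)) =
  \sum_(l.-1 <= k < j) F k.
Proof.
move=> il.
rewrite big_mkcond (sum_kidx V i j (fun k => if (l <= k.+1)%N then F k else 0)).
rewrite -big_mkcond /= (big_nat_widenl l.-1 i); last by lia.
by apply: eq_bigl => k; lia.
Qed.

Section Relaxation.
Context {R : realType} {N : nat} {v : variables R} (hv : relaxation R N v).

Lemma nu_first_eq0 (i m : nat) : (1 <= i)%N -> (i <= m <= N)%N ->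
  nuc v i i m = 0.
Proof.
case: hv => _ [hdiag hmc] [_ hz] _ _ i1 /andP[im mN].
have nuii : nuc v i i i = 0.
  have [|-> _] := hdiag i i; first by rewrite /inT; lia.
  by rewrite hz ?subrr //; lia.
have [->//|neq] := eqVneq m i.
(* McCormick with cut points [i] and [i.+1] bounds [nuc v i i m] above by [nuc v i i i = 0]; the
   maximum with 0 bounds it below. *)
have [|/(_ i i i.+1) hnu _] := hmc i m; first by rewrite /inP; lia.
move: hnu; rewrite ge_max le_min nuii => hnu.
apply/eqP; rewrite eq_le.
by have /andP[/andP[-> _] /andP[-> _]] := hnu ltac:(lia) ltac:(lia) ltac:(lia).
Qed.

Lemma omega_last_eq0 (n j : nat) : (1 <= n)%N -> (n <= j <= N)%N ->
  omegac v n j j = 0.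
Proof.
case: hv => _ [hdiag hmc] [_ hz] _ _ n1 /andP[nj jN].
have omjj : omegac v j j j = 0.
  have [|_ ->] := hdiag j j; first by rewrite /inT; lia.
  by rewrite hz ?subrr //; lia.
have [->//|neq] := eqVneq n j.
(* Mirror image: these indices give the upper bound [omegac v j j j = 0]. *)
have [|_ /(_ j j.-1 j) hom] := hmc n j; first by rewrite /inP; lia.
move: hom; rewrite ge_max le_min omjj => hom.
apply/eqP; rewrite eq_le.
by have /andP[/andP[-> _] /andP[_ ->]] := hom ltac:(lia) ltac:(lia) ltac:(lia).
Qed.

Lemma sum_tau (i j : nat) : inP N i j ->
  \sum_(i <= k < j) tau v i k j = zeta v i j.
Proof.
move=> hij; have /and3P[i1 ij jN] := hij.
case: (hv) => hsec [hdiag _] _ _ _.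
(* The secant formula for [tau] is the forward difference of [f]. The sum is [f j - f i], where
   [f i = 0] and [f j = 1 - (1 - zeta v i j)], the leading 1 being the convention for
   [nuc v i j j.-1]. *)
pose f k := nuc v i k j.-1 - nuc v i k j.
rewrite (@eq_big_nat _ _ _ _ _ _ (fun k => f k.+1 - f k)); last first.
  by move=> k kij; rewrite (hsec i j hij).1 // /f; ring.
rewrite telescope_sumr; last exact: ltnW.
rewrite /f (hdiag i j _).1; last by rewrite /inT; lia.
rewrite !nu_first_eq0 /nuc; try lia.
by rewrite prednK ?eqxx; [ring | lia].
Qed.

Lemma sum_beta (i j : nat) : inP N i j ->
  \sum_(i.+1 <= l < j.+1) beta v i l j = zeta v i j.
Proof.
move=> hij; have /and3P[i1 ij jN] := hij.
case: (hv) => hsec [hdiag _] _ _ _.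
(* Here [f j = 0], and the convention [omegac v i.+1 i j = 1] gives [f i = - zeta v i j]. *)
pose f l := omegac v i l j - omegac v i.+1 l j.
rewrite big_add1 /= (@eq_big_nat _ _ _ _ _ _ (fun l => f l.+1 - f l)); last first.
  by move=> l lij; rewrite (hsec i j hij).2 // /f /=; ring.
rewrite telescope_sumr; last exact: ltnW.
rewrite /f (hdiag i j _).2; last by rewrite /inT; lia.
rewrite !omega_last_eq0 /omegac; try lia.
by rewrite eqxx; ring.
Qed.

Lemma sum_sigma_row (i j : nat) (k : kidx i j) : inP N i j ->
  \sum_(l : lidx i j | (val (val l) <= (val (val k)).+1)%N)
    sigma v i (val (val k)) (val (val l)) j = tau v i (val (val k)) j.
Proof.
move=> hij; case: (hv) => _ _ _ /(_ i j hij)[row _ _] _.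
rewrite -row; last by rewrite (valP k) ltn_ord.
exact: (sum_lidx_le _ i j _ (fun l => sigma v i (val (val k)) l j) (ltn_ord _)).
Qed.

Lemma sum_sigma_col (i j : nat) (l : lidx i j) : inP N i j ->
  \sum_(k : kidx i j | (val (val l) <= (val (val k)).+1)%N)
    sigma v i (val (val k)) (val (val l)) j = beta v i (val (val l)) j.
Proof.
move=> hij; case: (hv) => _ _ _ /(_ i j hij)[_ col _] _.
rewrite -col; last by rewrite (valP l) -ltnS ltn_ord.
exact: (sum_kidx_ge _ i j _ (fun k => sigma v i k (val (val l)) j) (valP l)).
Qed.

End Relaxation.

(** The binary conditions leave only these points and the origin in [product_set]. *)
Definition split_vertex (R : realType) (i j : nat) (x : klidx i j) :
    subvec_space R i j :=
  ([ffun y : klidx i j => (y == x)%:R],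
   [ffun k : kidx i j => (k == (val x).1)%:R],
   [ffun l : lidx i j => (l == (val x).2)%:R],
   1).

Lemma product_set_split_vertex (R : realType) (i j : nat) (x : klidx i j) :
  product_set R i j (split_vertex R i j x).
Proof.
split=> /=.
- move=> y; rewrite !ffunE -natrM mulnb -xpair_eqE -!surjective_pairing.
  by rewrite val_eqE.
- move=> k l kl; rewrite !ffunE -natrM mulnb.
  case: eqP => [ek|//]; case: eqP => [el|//].
  (* Both indicators being 1 would make [(k, l)] the pair [x], whose membership in [klidx] says
     [l <= k + 1]. *)
  by have := valP x; rewrite /= -ek -el leqNgt kl.
- split; under eq_bigr do rewrite ffunE.
  + by rewrite (bigD1 (val x).1) //= eqxx big1 ?addr0 // => k /negbTE->.
  + by rewrite (bigD1 (val x).2) //= eqxx big1 ?addr0 // => l /negbTE->.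
- split; last by right.
  + by move=> k; rewrite ffunE; case: eqP; [right | left].
  + by move=> l; rewrite ffunE; case: eqP; [right | left].
Qed.

Lemma product_set0 (R : realType) (i j : nat) : product_set R i j 0.
Proof.
split=> /=.
- by move=> y; rewrite !ffunE mulr0.
- by move=> k l _; rewrite !ffunE mulr0.
- by split; rewrite big1 // => x _; rewrite ffunE.
- by split; [move=> k; rewrite ffunE; left | move=> l; rewrite ffunE; left | left].
Qed.

Lemma sum_split_vertex (R : realType) (i j : nat) (w : klidx i j -> R) :
  \sum_x w x *: split_vertex R i j x =
  ([ffun y : klidx i j => w y],
   [ffun k : kidx i j => \sum_(x | k == (val x).1) w x],
   [ffun l : lidx i j => \sum_(x | l == (val x).2) w x],
   \sum_x w x) :> subvec_space R i j.
Proof.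
have pick (I : finType) (P : pred I) (F : I -> R) :
    \sum_x F x * (P x)%:R = \sum_(x | P x) F x.
  by rewrite [RHS]big_mkcond; apply: eq_bigr => x _; case: (P x);
    rewrite ?mulr1 ?mulr0.
have proj (V : nmodType) (f : subvec_space R i j -> V) (F : klidx i j -> _) :
    {morph f : x y / x + y} -> f 0 = 0 -> f (\sum_x F x) = \sum_x f (F x).
  by move=> fD f0; apply: big_morph.
(* Naming the four components lets [congr] separate them; each is then computed by pushing its
   additive projection through the sum. *)
case E: (\sum_x _) => [[[s t] b] z].
have sE : s = (\sum_x w x *: split_vertex R i j x).1.1.1 by rewrite E.
have tE : t = (\sum_x w x *: split_vertex R i j x).1.1.2 by rewrite E.
have bE : b = (\sum_x w x *: split_vertex R i j x).1.2 by rewrite E.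
have zE : z = (\sum_x w x *: split_vertex R i j x).2 by rewrite E.
congr (_, _, _, _).
- rewrite sE (proj _ (fun x : subvec_space R i j => x.1.1.1)) //.
  apply/ffunP => y; rewrite sum_ffunE ffunE.
  under eq_bigr do rewrite !ffunE.
  by rewrite [LHS]pick (big_pred1 y) // => x; rewrite eq_sym.
- rewrite tE (proj _ (fun x : subvec_space R i j => x.1.1.2)) //.
  apply/ffunP => k; rewrite sum_ffunE ffunE.
  under eq_bigr do rewrite !ffunE.
  exact: pick.
- rewrite bE (proj _ (fun x : subvec_space R i j => x.1.2)) //.
  apply/ffunP => l; rewrite sum_ffunE ffunE.
  under eq_bigr do rewrite !ffunE.
  exact: pick.
- rewrite zE (proj _ (fun x : subvec_space R i j => x.2)) //.
  by apply: eq_bigr => x _; apply: mulr1.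
Qed.

Theorem proposition3 (R : realType) (N : nat) (hN : (2 <= N)%N)
    (v : variables R) (hv : relaxation R N v)
    (i j : nat) (hij : inP N i j) :
  conv_hull (product_set R i j) (subvector v i j).
Proof.
pose w (x : klidx i j) := sigma v i (val (val (val x).1)) (val (val (val x).2)) j.
have tauE (k : kidx i j) : \sum_(x | k == (val x).1) w x = tau v i (val k) j.
  (* In the double sum over [k'] and [l], only the row [k' = k] survives. *)
  rewrite -(sum_sigma_row hv) // big_mkcond.
  rewrite (sum_klidx _ i j (fun k' l => if k == k' then
    sigma v i (val (val k')) (val (val l)) j else 0)).
  rewrite (bigD1 k) //= eqxx [X in _ + X]big1 ?addr0 // => k' /negbTE.
  by rewrite eq_sym => ->; rewrite big1.
have betaE (l : lidx i j) : \sum_(x | l == (val x).2) w x = beta v i (val l) j.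
  rewrite -(sum_sigma_col hv) // big_mkcond.
  rewrite (sum_klidx _ i j (fun k l' => if l == l' then
    sigma v i (val (val k)) (val (val l')) j else 0)).
  (* The fixed index is now the inner one, so the sides are compared for each [k]: both equal the
     entry at [l] if [l <= k + 1], and 0 otherwise. *)
  rewrite [RHS]big_mkcond; apply: eq_bigr => k _; rewrite big_mkcond /=.
  rewrite (bigD1 l) //= eqxx [X in _ + X]big1 ?addr0 // => l' /negbTE.
  by rewrite eq_sym => ->; rewrite if_same.
have zetaE : \sum_x w x = zeta v i j.
  rewrite -(sum_tau hv) // -(sum_kidx _ i j (fun k => tau v i k j)).
  rewrite (sum_klidx _ i j (fun k l => sigma v i (val (val k)) (val (val l)) j)).
  by apply: eq_bigr => k _; rewrite (sum_sigma_row hv).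
have -> : subvector v i j = \sum_x w x *: split_vertex R i j x.
  rewrite sum_split_vertex zetaE; congr (_, _, _, _).
  - by apply/ffunP => k; rewrite !ffunE tauE.
  - by apply/ffunP => l; rewrite !ffunE betaE.
case: (hv) => _ _ _ /(_ i j hij)[_ _ sigma_ge0] zeta01.
apply: conv_hull_subconvex.
- exact: product_set0.
- move=> x; apply: sigma_ge0; first by rewrite (valP (val x).1) ltn_ord.
  by rewrite (valP (val x).2) (valP x).
(* The total weight is [zeta v i j], so its upper bound 1 is what leaves a nonnegative weight for
   the origin. *)
- rewrite zetaE; suff /zeta01/andP[] : inT N i j by [].
  by move: hij; rewrite /inP /inT; lia.
- exact: product_set_split_vertex.
Qed.
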